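(* Let $n$ be a positive integer. There exists a continuous non-affine function $g:\mathbb R\to\mathbb R$ such that, for every compact set $K\subset\mathbb R^n$, the class $\mathcal S_n$ generated from $g$ and the coordinate functions $x_1,\dots,x_n$ by repeated addition and composition is dense in $C(K)$; that is, for every $f\in C(K)$ and every $\varepsilon>0$ there exists $F\in\mathcal S_n$ such that $\sup_{\mathbf x\in K}|f(\mathbf x)-F(\mathbf x)|<\varepsilon$.
   Context: A function $g:\mathbb R\to\mathbb R$ is affine if it has the form $g(t)=at+b$ with $a,b\in\mathbb R$ (including constant functions), and non-affine otherwise. $C(K)$ denotes the space of real-valued continuous functions on $K$ with the uniform norm. The coordinate function $x_j$ is the map $\mathbb R^n\to\mathbb R$, $(x_1,\dots,x_n)\mapsto x_j$. The class generated from $g$ and the coordinate functions by repeated addition and composition is the smallest class $\mathcal S_n$ of real-valued functions on $\mathbb R^n$ such that: (i) the coordinate functions $x_1,\dots,x_n$ belong to $\mathcal S_n$; (ii) if $u,v\in\mathcal S_n$, then $u+v\in\mathcal S_n$ (pointwise sum); (iii) if $u\in\mathcal S_n$, then $g\circ u\in\mathcal S_n$. *)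

(* Defs.v *)
From HB Require Import structures.
From mathcomp Require Import all_boot all_order all_algebra.
From mathcomp Require Import all_classical all_reals all_analysis.
Set Implicit Arguments.
Unset Strict Implicit.
Unset Printing Implicit Defensive.
Import Order.TTheory GRing.Theory Num.Theory.
Import numFieldNormedType.Exports.
Local Open Scope classical_set_scope.
Local Open Scope ring_scope.

Definition affine (R : realType) (g : R -> R) : Prop :=
  exists a b : R, forall t : R, g t = a * t + b.

Inductive generated (R : realType) (n : nat) (g : R -> R) :
    ('rV[R]_n -> R) -> Prop :=
| generated_coord (j : 'I_n) : generated g (fun x => x ord0 j)
| generated_add (u v : 'rV[R]_n -> R) :
    generated g u -> generated g v -> generated g (fun x => u x + v x)
| generated_comp (u : 'rV[R]_n -> R) :
    generated g u -> generated g (fun x => g (u x)).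

(* The supremum is taken in the extended reals, so that it is never a default
   value: it is +oo on unbounded families and -oo when K is empty. *)
Definition sup_dist (R : realType) (n : nat) (K : set 'rV[R]_n)
    (f F : 'rV[R]_n -> R) : \bar R :=
  ereal_sup [set (`|f x - F x|)%:E | x in K].

(* An element of C(K) is represented by a function on the whole space whose
   restriction to K is continuous; its values outside K are irrelevant. *)
Definition dense_in_C (R : realType) (n : nat) (K : set 'rV[R]_n)
    (S : set ('rV[R]_n -> R)) : Prop :=
  forall f : 'rV[R]_n -> R, {within K, continuous f} ->
  forall eps : R, 0 < eps ->
  exists2 F : 'rV[R]_n -> R, S F & (sup_dist K f F < eps%:E)%E.

(* Main.v *)
Require Import Defs.
From HB Require Import structures.
From mathcomp Require Import all_boot all_order all_algebra.
From mathcomp Require Import all_classical all_reals all_analysis.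
From mathcomp Require Import ring lra.
Import Order.TTheory GRing.Theory Num.Theory.
Import numFieldNormedType.Exports.
Local Open Scope classical_set_scope.
Local Open Scope ring_scope.
Set Implicit Arguments.
Unset Strict Implicit.

(** The function used is the tent [g t = 1 - |t| / 2].  It is a contraction, so
    its iterates at a coordinate function converge, uniformly on a compact set,
    to its fixed point [2/3]; this puts the constant [2/3] in the closure of
    the generated class, and sums together with [g (4 * (2/3)) = - (1/3)] give
    all integer constants.

    Constants make it possible to move the argument of [g] into the half-line
    on which [g] is affine with slope [- 1/2]: if [|u| <= N] on [K], then
    [g (u + 2 N) + (N - 1) = - (u / 2)].  Hence the closure is stable under
    multiplication by [- 1/2], therefore by every dyadic number and, by a
    limit, by every real number: it is a vector space containing the constants
    and the coordinates.  As [|u| = 2 - 2 g u], it is also a lattice.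

    Affine functions of one coordinate take arbitrary prescribed values at two
    distinct points, and the lattice form of the Stone-Weierstrass theorem
    ([lattice_stone_weierstrass]) then gives density. *)

(** * The lattice form of the Stone-Weierstrass theorem *)

(** Compactness is used through the filter of upper sections of [B] for the
    pointwise order, which directedness makes a filter: near a point of [K],
    one member of [B] exceeds [f], and so do all larger members; near-covering
    turns this into a single threshold valid on the whole of [K]. *)
Lemma compact_directed_gt (R : realType) (T : topologicalType) (K : set T)
    (f : T -> R) (B : set (T -> R)) :
  compact K -> {within K, continuous f} ->
  (forall h, B h -> {within K, continuous h}) ->
  B !=set0 -> (forall h k, B h -> B k -> B (h \max k)) ->
  (forall y, K y -> exists2 h, B h & f y < h y) ->
  exists2 h, B h & forall y, K y -> f y < h y.
Proof.
move=> /compact_near_coveringP Kco /subspace_continuousP fc Bc [b0 Bb0] Bmax fB.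
pose F : set_system (T -> R) := [set Q | exists2 h0, B h0 &
  forall h, B h -> (forall z, h0 z <= h z) -> Q h].
have FF : Filter F.
  split.
  - by exists b0.
  - move=> P Q [h Bh hP] [k Bk kQ]; exists (h \max k); first exact: Bmax.
    move=> m Bm hkm; split.
      by apply: hP => // z; apply: le_trans (hkm z); rewrite le_max lexx.
    by apply: kQ => // z; apply: le_trans (hkm z); rewrite le_max lexx orbT.
  - move=> P Q PQ [h Bh hP]; exists h => // k Bk hk; exact/PQ/hP.
have [|h Bh hK] := Kco _ F (fun h z => K z -> f z < h z) FF.
  move=> y Ky; have [h Bh fh] := fB y Ky.
  have /subspace_continuousP hc := Bc h Bh.
  have fhnear : \forall z \near y, K z -> f z < h z.
    have hf0 : 0 < h y - f y by rewrite subr_gt0.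
    have Fw : Filter (within K (nbhs y)) by exact: within_filter.
    have := cvgr_gt _ (cvgB (hc y Ky) (fc y Ky)) _ hf0.
    move=> /(_ Fw Fw); rewrite near_withinE.
    by apply: filterS => z + Kz => /(_ Kz); rewrite subr_gt0.
  exists ([set z | K z -> f z < h z], [set k | B k /\ forall z, h z <= k z]).
    by split=> //=; exists h.
  move=> [z k] /= [fz [_ hk]] Kz.
  exact: lt_le_trans (fz Kz) (hk z).
exists h => // y Ky; exact: hK.
Qed.

(** The previous lemma applied to the opposite functions. *)
Lemma compact_directed_lt (R : realType) (T : topologicalType) (K : set T)
    (f : T -> R) (B : set (T -> R)) :
  compact K -> {within K, continuous f} ->
  (forall h, B h -> {within K, continuous h}) ->
  B !=set0 -> (forall h k, B h -> B k -> B (h \min k)) ->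
  (forall y, K y -> exists2 h, B h & h y < f y) ->
  exists2 h, B h & forall y, K y -> h y < f y.
Proof.
move=> Kco fc Bc [b0 Bb0] Bmin Bf.
have oppc (k : T -> R) : {within K, continuous k} ->
    {within K, continuous (\- k)}.
  by move=> kc x; apply: continuousN; exact: kc.
have oppK (k : T -> R) : (\- (\- k)) = k by apply/funext => x /=; rewrite opprK.
have [|||||h Bh fh] := @compact_directed_gt R T K (\- f) [set k | B (\- k)] Kco.
- exact: oppc.
- by move=> h /Bc /oppc; rewrite oppK.
- by exists (\- b0); rewrite /= oppK.
- move=> h k /= Bh Bk; have := Bmin _ _ Bh Bk; congr B.
  by apply/funext => x /=; rewrite oppr_max.
- move=> y Ky; have [h Bh hf] := Bf y Ky.
  by exists (\- h); rewrite /= ?oppK // ltrN2.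
by exists (\- h) => // y Ky; rewrite /= ltrNl; exact: fh.
Qed.

(** First enlarge, keeping the value at [x] exact: this gives members of [A]
    above [f - eps] on [K] that agree with [f] at [x].  The members of [A]
    above [f - eps] are stable under [min], and the previous ones show that at
    every point some of them are below [f + eps]. *)
Lemma lattice_stone_weierstrass (R : realType) (T : topologicalType)
    (K : set T) (A : set (T -> R)) (f : T -> R) (eps : R) :
  compact K -> A !=set0 ->
  (forall h, A h -> {within K, continuous h}) ->
  (forall h k, A h -> A k -> A (h \max k)) ->
  (forall h k, A h -> A k -> A (h \min k)) ->
  (forall x y, K x -> K y -> exists h, [/\ A h, h x = f x & h y = f y]) ->
  {within K, continuous f} -> 0 < eps ->
  exists2 h, A h & forall x, K x -> `|f x - h x| < eps.
Proof.
move=> Kco [a0 Aa0] Ac Amax Amin interp fc eps0.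
have shift (e : R) : {within K, continuous (fun y => f y + e)}.
  by move=> y; apply: continuousD; [exact: fc | exact: cst_continuous].
have above x : K x -> exists h, [/\ A h, h x = f x &
    forall y, K y -> f y - eps < h y].
  move=> Kx.
  have [||||h [Ah hx] fh] := @compact_directed_gt R T K
      (fun y => f y - eps) [set h | A h /\ h x = f x] Kco (shift _).
  - by move=> h [/Ac].
  - by have [h [Ah hx _]] := interp x x Kx Kx; exists h.
  - move=> h k [Ah hx] [Ak kx]; split; first exact: Amax.
    by rewrite /= hx kx maxxx.
  - move=> y Ky; have [h [Ah hx hy]] := interp x y Kx Ky.
    by exists h => //; rewrite hy ltrBlDr ltrDl.
  by exists h.
have [||||h [Ah hlo] hup] := @compact_directed_lt R T K
    (fun y => f y + eps) [set h | A h /\ forall y, K y -> f y - eps < h y]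
    Kco (shift _).
- by move=> h [/Ac].
- have [K0|] := pselect (K !=set0).
    case: K0 => x Kx; have [h [Ah _ hf]] := above x Kx.
    by exists h.
  by move=> K0; exists a0; split=> // y Ky; case: K0; exists y.
- move=> h k [Ah hf] [Ak kf]; split; first exact: Amin.
  by move=> y Ky; rewrite /= lt_min hf ?kf.
- move=> y Ky; have [h [Ah hy hf]] := above y Ky.
  by exists h => //; rewrite hy ltrDl.
by exists h => // x Kx; rewrite distrC ltr_distl hlo ?hup.
Qed.

(** * The closure of the class generated by the tent *)

Definition tent (R : realType) (t : R) : R := 1 - `|t| / 2.

Lemma tent_continuous (R : realType) : continuous (@tent R).
Proof.
move=> t; apply: cvgB; first exact: cvg_cst.
apply: cvgM; last exact: cvg_cst.
exact: norm_continuous.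
Qed.

Lemma tent_lipschitz (R : realType) (s t : R) :
  `|tent s - tent t| <= `|s - t| / 2.
Proof.
have -> : tent s - tent t = (`|t| - `|s|) / 2 by rewrite /tent; field.
rewrite normrM [`|2^-1|]ger0_norm ?invr_ge0 // ler_wpM2r ?invr_ge0 //.
by rewrite [leRHS]distrC ler_dist_dist.
Qed.

Lemma tent_not_affine (R : realType) : ~ affine (@tent R).
Proof.
move=> [a [b tentE]].
have := tentE 0; have := tentE 1; have := tentE (-1).
rewrite /tent normrN normr0 normr1 => h1 h2 h3.
have : (0 : R) < 0 by lra.
by rewrite ltxx.
Qed.

Lemma exists_pow2_le (R : realType) (M eps : R) : 0 < eps ->
  exists k : nat, M / 2 ^+ k <= eps.
Proof.
move=> eps0; exists (Num.bound `|M / eps|).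
have pow0 : 0 < 2 ^+ Num.bound `|M / eps| :> R by rewrite exprn_gt0.
rewrite ler_pdivrMr // mulrC -ler_pdivrMr //.
apply: le_trans (ler_norm _) _; apply/ltW.
apply: lt_trans (archi_boundP (normr_ge0 _)) _.
rewrite -natrX ltr_nat.
exact: ltn_expl.
Qed.

(** The uniform closure on [K] of the class generated by the tent. *)
Definition approximable (R : realType) (n : nat) (K : set 'rV[R]_n)
    (f : 'rV[R]_n -> R) : Prop :=
  forall eps : R, 0 < eps -> exists2 F, generated (@tent R) F &
    forall x, K x -> `|f x - F x| <= eps.

Definition bounded_on (R : realType) (n : nat) (K : set 'rV[R]_n)
    (f : 'rV[R]_n -> R) : Prop :=
  exists M : R, forall x, K x -> `|f x| <= M.

Lemma coord_bounded_on (R : realType) (n : nat) (K : set 'rV[R]_n) (j : 'I_n) :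
  compact K -> bounded_on K (fun x => x ord0 j).
Proof.
move=> Kco.
have cc : {within K, continuous (fun x : 'rV[R]_n => x ord0 j)}.
  by apply: continuous_subspaceT; exact: coord_continuous.
have := compact_bounded (V := R^o) (continuous_compact cc Kco).
move=> [M [_ HM]]; exists (M + 1) => x Kx.
by apply: (HM (M + 1)); [rewrite ltrDl | exists x].
Qed.

Lemma generated_bounded_on (R : realType) (n : nat) (K : set 'rV[R]_n)
    (F : 'rV[R]_n -> R) :
  compact K -> generated (@tent R) F -> bounded_on K F.
Proof.
move=> Kco; elim=> {F} [j | u v _ [M uM] _ [N vN] | u _ [M uM]].
- exact: coord_bounded_on.
- exists (M + N) => x Kx; apply: le_trans (ler_normD _ _) _.
  by rewrite lerD ?uM ?vN.
- exists (1 + M) => x Kx; have := uM x Kx; rewrite /tent.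
  have := normr_ge0 (u x).
  by move: `|u x| => r r0 rM; rewrite ler_norml; apply/andP; split; lra.
Qed.

Lemma approximable_bounded_on (R : realType) (n : nat) (K : set 'rV[R]_n)
    (f : 'rV[R]_n -> R) :
  compact K -> approximable K f -> bounded_on K f.
Proof.
move=> Kco /(_ 1 ltr01) [F /(generated_bounded_on Kco) [M FM] fF].
exists (1 + M) => x Kx; rewrite -[f x](subrK (F x)).
by apply: le_trans (ler_normD _ _) _; rewrite lerD ?fF ?FM.
Qed.

Lemma approximable_coord (R : realType) (n : nat) (K : set 'rV[R]_n)
    (j : 'I_n) : approximable K (fun x => x ord0 j).
Proof.
move=> eps eps0; exists (fun x => x ord0 j); first exact: generated_coord.
by move=> x _; rewrite subrr normr0 ltW.
Qed.

Lemma approximable_add (R : realType) (n : nat) (K : set 'rV[R]_n)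
    (u v : 'rV[R]_n -> R) : approximable K u -> approximable K v ->
  approximable K (fun x => u x + v x).
Proof.
move=> au av eps eps0; have eps20 : 0 < eps / 2 by rewrite divr_gt0.
have [F gF uF] := au _ eps20; have [G gG vG] := av _ eps20.
exists (fun x => F x + G x); first exact: generated_add.
move=> x Kx; have -> : u x + v x - (F x + G x) = (u x - F x) + (v x - G x).
  by ring.
by apply: le_trans (ler_normD _ _) _; rewrite [leRHS]splitr lerD ?uF ?vG.
Qed.

Lemma approximable_tent (R : realType) (n : nat) (K : set 'rV[R]_n)
    (u : 'rV[R]_n -> R) : approximable K u ->
  approximable K (fun x => tent (u x)).
Proof.
move=> au eps eps0; have [F gF uF] := au _ eps0.
exists (fun x => tent (F x)); first exact: generated_comp.
move=> x Kx; apply: le_trans (tent_lipschitz _ _) _.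
by have := uF x Kx; have := normr_ge0 (u x - F x); lra.
Qed.

Lemma approximable_limit (R : realType) (n : nat) (K : set 'rV[R]_n)
    (f : 'rV[R]_n -> R) :
  (forall eps : R, 0 < eps -> exists2 h, approximable K h &
     forall x, K x -> `|f x - h x| <= eps) -> approximable K f.
Proof.
move=> fh eps eps0; have eps20 : 0 < eps / 2 by rewrite divr_gt0.
have [h ah hf] := fh _ eps20; have [F gF hF] := ah _ eps20.
exists F => // x Kx; rewrite -[f x](subrK (h x)) -addrA.
by apply: le_trans (ler_normD _ _) _; rewrite [leRHS]splitr lerD ?hf ?hF.
Qed.

Lemma approximable_eq (R : realType) (n : nat) (K : set 'rV[R]_n)
    (f h : 'rV[R]_n -> R) :
  (forall x, K x -> f x = h x) -> approximable K h -> approximable K f.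
Proof.
move=> fh ah; apply: approximable_limit => eps eps0; exists h => // x Kx.
by rewrite fh // subrr normr0 ltW.
Qed.

(** * Constants *)

(** The tent fixes [2 / 3] and halves distances, so its iterates at a
    coordinate, which is bounded on [K], converge uniformly to [2 / 3]. *)
Lemma approximable_fixpoint (R : realType) (n : nat) (K : set 'rV[R]_n) :
  (0 < n)%N -> compact K -> approximable K (fun=> 2 / 3).
Proof.
move=> n0 Kco; pose j := Ordinal n0.
have [M xM] := coord_bounded_on j Kco.
have iter_tent (k : nat) : exists2 F, generated (@tent R) F &
    forall x, K x -> `|2 / 3 - F x| <= (1 + M) / 2 ^+ k.
  elim: k => [|k [F gF FM]].
    exists (fun x => x ord0 j); first exact: generated_coord.
    move=> x Kx; rewrite expr0 divr1; apply: le_trans (ler_normB _ _) _.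
    by rewrite lerD ?xM // ger0_norm; lra.
  exists (fun x => tent (F x)); first exact: generated_comp.
  move=> x Kx; have fix23 : 2 / 3 = tent (2 / 3 : R).
    by rewrite /tent ger0_norm; lra.
  rewrite {1}fix23; apply: le_trans (tent_lipschitz _ _) _.
  by rewrite exprSr invfM mulrA ler_wpM2r ?invr_ge0 // FM.
move=> eps eps0; have [k Mk] := exists_pow2_le (1 + M) eps0.
have [F gF FM] := iter_tent k; exists F => // x Kx.
exact: le_trans (FM x Kx) Mk.
Qed.

Lemma approximable_natmul (R : realType) (n : nat) (K : set 'rV[R]_n)
    (u : 'rV[R]_n -> R) (m : nat) :
  approximable K u -> approximable K (fun x => u x *+ m.+1).
Proof.
move=> au; elim: m => [|m IHm]; first by apply: approximable_eq au.
apply: approximable_eq (approximable_add au IHm) => x _.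
by rewrite -mulrS.
Qed.

(** From [2 / 3], the value [tent (4 * (2 / 3)) = - (1 / 3)] supplies the
    negative sign that sums alone cannot produce; [-1] is three times it, and
    [1 = 3 * (2 / 3 - 1 / 3)]. *)
Lemma approximable_int (R : realType) (n : nat) (K : set 'rV[R]_n) (m : int) :
  (0 < n)%N -> compact K -> approximable K (fun=> m%:~R).
Proof.
move=> n0 Kco; have a23 := approximable_fixpoint n0 Kco.
have aN13 : approximable K (fun=> - (1 / 3)).
  apply: approximable_eq (approximable_tent (approximable_natmul 3 a23)).
  by move=> x _; rewrite /tent ger0_norm; lra.
have aN1 : approximable K (fun=> -1).
  by apply: approximable_eq (approximable_natmul 2 aN13) => x _; lra.
have a1 : approximable K (fun=> 1).
  apply: approximable_eq (approximable_natmul 2 (approximable_add a23 aN13)).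
  by move=> x _; lra.
have a0 : approximable K (fun=> 0).
  by apply: approximable_eq (approximable_add a1 aN1) => x _; rewrite subrr.
case: m => [[|m]|m]; first by apply: approximable_eq a0 => x _.
  by apply: approximable_eq (approximable_natmul m a1) => x _.
apply: approximable_eq (approximable_natmul m aN1) => x _.
by rewrite NegzE mulrNz mulNrn.
Qed.

(** * Linear and lattice operations *)

(** The translate by [2 N] moves the values of [u] on [K] to the half-line on
    which the tent has slope [- 1/2]. *)
Lemma approximable_neg_half (R : realType) (n : nat) (K : set 'rV[R]_n)
    (u : 'rV[R]_n -> R) :
  (0 < n)%N -> compact K -> approximable K u ->
  approximable K (fun x => - (u x / 2)).
Proof.
move=> n0 Kco au; have [M uM] := approximable_bounded_on Kco au.
pose N : int := Num.bound M.
have MN x : K x -> `|u x| <= N%:~R.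
  move=> Kx; have M0 : 0 <= M := le_trans (normr_ge0 _) (uM x Kx).
  exact: le_trans (uM x Kx) (ltW (archi_boundP M0)).
have cst m := approximable_int m n0 Kco.
have := approximable_add (approximable_tent (approximable_add au (cst (N + N))))
  (cst (N - 1)).
apply: approximable_eq => x Kx; have := MN x Kx.
rewrite ler_norml /tent rmorphD rmorphB /= => /andP[uN Nu].
by rewrite ger0_norm; lra.
Qed.

Lemma approximable_opp (R : realType) (n : nat) (K : set 'rV[R]_n)
    (u : 'rV[R]_n -> R) :
  (0 < n)%N -> compact K -> approximable K u ->
  approximable K (fun x => - u x).
Proof.
move=> n0 Kco au; have au2 := approximable_neg_half n0 Kco au.
by apply: approximable_eq (approximable_add au2 au2) => x _; field.
Qed.

Lemma approximable_intmul (R : realType) (n : nat) (K : set 'rV[R]_n)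
    (u : 'rV[R]_n -> R) (m : int) :
  (0 < n)%N -> compact K -> approximable K u ->
  approximable K (fun x => m%:~R * u x).
Proof.
move=> n0 Kco au; case: m => [[|m]|m].
- apply: approximable_eq (approximable_int 0 n0 Kco) => x _.
  by rewrite mul0r.
- apply: approximable_eq (approximable_natmul m au) => x _.
  by rewrite -mulr_natl.
- apply: approximable_eq (approximable_opp n0 Kco (approximable_natmul m au)).
  by move=> x _; rewrite NegzE mulrNz mulNr -mulr_natl.
Qed.

Lemma approximable_pow2 (R : realType) (n : nat) (K : set 'rV[R]_n)
    (u : 'rV[R]_n -> R) (k : nat) :
  (0 < n)%N -> compact K -> approximable K u ->
  approximable K (fun x => u x / 2 ^+ k).
Proof.
move=> n0 Kco au; elim: k => [|k IHk].
  by apply: approximable_eq au => x _; rewrite expr0 divr1.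
apply: approximable_eq (approximable_opp n0 Kco
  (approximable_neg_half n0 Kco IHk)) => x _.
by rewrite opprK exprSr invfM mulrA.
Qed.

(** Replacing [a] by the dyadic number [floor (a 2^k) / 2^k] changes [a * u] by
    at most [M / 2^k] when [|u| <= M] on [K]. *)
Lemma approximable_scale (R : realType) (n : nat) (K : set 'rV[R]_n)
    (u : 'rV[R]_n -> R) (a : R) :
  (0 < n)%N -> compact K -> approximable K u ->
  approximable K (fun x => a * u x).
Proof.
move=> n0 Kco au; have [M uM] := approximable_bounded_on Kco au.
apply: approximable_limit => eps eps0.
have [k Mk] := exists_pow2_le M eps0.
have pow0 : 0 < 2 ^+ k :> R by rewrite exprn_gt0.
exists (fun x => (Num.floor (a * 2 ^+ k))%:~R * (u x / 2 ^+ k)).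
  by apply: approximable_intmul => //; exact: approximable_pow2.
move=> x Kx; apply: le_trans Mk.
have -> : a * u x - (Num.floor (a * 2 ^+ k))%:~R * (u x / 2 ^+ k) =
    (a * 2 ^+ k - (Num.floor (a * 2 ^+ k))%:~R) * u x / 2 ^+ k.
  by field; rewrite gt_eqF.
rewrite normrM [`|_^-1|]gtr0_norm ?invr_gt0 // ler_pM2r ?invr_gt0 //.
apply: le_trans (uM x Kx); rewrite normrM ler_piMl //.
have /andP[lo hi] := floor_itv (a * 2 ^+ k).
rewrite rmorphD /= in hi.
by rewrite ger0_norm ?subr_ge0 // lerBlDl ltW.
Qed.

Lemma approximable_cst (R : realType) (n : nat) (K : set 'rV[R]_n) (a : R) :
  (0 < n)%N -> compact K -> approximable K (fun=> a).
Proof.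
move=> n0 Kco.
apply: approximable_eq (approximable_scale a n0 Kco
  (approximable_int 1 n0 Kco)) => x _.
by rewrite mulr1.
Qed.

Lemma approximable_norm (R : realType) (n : nat) (K : set 'rV[R]_n)
    (u : 'rV[R]_n -> R) :
  (0 < n)%N -> compact K -> approximable K u ->
  approximable K (fun x => `|u x|).
Proof.
move=> n0 Kco au.
apply: approximable_eq (approximable_add (approximable_cst 2 n0 Kco)
  (approximable_scale (-2) n0 Kco (approximable_tent au))) => x _.
by rewrite /tent; field.
Qed.

Lemma approximable_max (R : realType) (n : nat) (K : set 'rV[R]_n)
    (u v : 'rV[R]_n -> R) :
  (0 < n)%N -> compact K -> approximable K u -> approximable K v ->
  approximable K (u \max v).
Proof.
move=> n0 Kco au av.
have auv := approximable_norm n0 Kco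
  (approximable_add au (approximable_opp n0 Kco av)).
apply: approximable_eq (approximable_scale (1 / 2) n0 Kco
  (approximable_add (approximable_add au av) auv)) => x _ /=.
by rewrite maxr_absE; field.
Qed.

Lemma approximable_min (R : realType) (n : nat) (K : set 'rV[R]_n)
    (u v : 'rV[R]_n -> R) :
  (0 < n)%N -> compact K -> approximable K u -> approximable K v ->
  approximable K (u \min v).
Proof.
move=> n0 Kco au av; have opp := approximable_opp n0 Kco.
apply: approximable_eq (opp _ (approximable_max n0 Kco (opp _ au) (opp _ av))).
by move=> x _ /=; rewrite oppr_max !opprK.
Qed.

(** * Density *)

Lemma continuous_affine_comp (R : realType) (T : topologicalType)
    (h : T -> R) (a b : R) :
  continuous h -> continuous (fun z => a * h z + b).
Proof.
move=> hc z; apply: cvgD; last exact: cvg_cst.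
by apply: cvgM; [exact: cvg_cst | exact: hc].
Qed.

(** Two distinct points differ in some coordinate, and an affine function of
    that coordinate takes any two prescribed values at them. *)
Lemma approximable_interpolation (R : realType) (n : nat) (K : set 'rV[R]_n)
    (f : 'rV[R]_n -> R) (x y : 'rV[R]_n) :
  (0 < n)%N -> compact K -> K x -> K y ->
  exists h, [/\ {within K, continuous h} /\ approximable K h,
    h x = f x & h y = f y].
Proof.
move=> n0 Kco Kx Ky.
have affine_ok (a b : R) (j : 'I_n) :
    {within K, continuous (fun z : 'rV[R]_n => a * z ord0 j + b)} /\
    approximable K (fun z => a * z ord0 j + b).
  split.
    apply: continuous_subspaceT; apply: continuous_affine_comp.
    exact: coord_continuous.
  apply: approximable_add; last exact: approximable_cst.
  by apply: approximable_scale => //; exact: approximable_coord.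
have [<-|/eqP/rowP/existsNP[j /eqP xy]] := eqVneq x y.
  exists (fun z => 0 * z ord0 (Ordinal n0) + f x).
  by split; [exact: affine_ok | rewrite mul0r add0r..].
pose a := (f y - f x) / (y ord0 j - x ord0 j).
exists (fun z => a * z ord0 j + (f x - a * x ord0 j)).
split; [exact: affine_ok | by ring |].
by rewrite /a; field; rewrite subr_eq0 eq_sym.
Qed.

Theorem corollary4p2 (R : realType) (n : nat) (n_gt0 : (0 < n)%N) :
  exists g : R -> R,
    [/\ continuous g,
        ~ affine g &
        forall K : set 'rV[R]_n, compact K -> dense_in_C K (generated g)].
Proof.
exists (@tent R); split; [exact: tent_continuous | exact: tent_not_affine |].
move=> K Kco f fc eps eps0.
pose A := [set h : 'rV[R]_n -> R |
  {within K, continuous h} /\ approximable K h].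
(* A half is lost to the strict inequality between suprema, and the other half
   is shared by the two approximations. *)
have eps40 : 0 < eps / 4 by rewrite divr_gt0.
have [|||||||h [_ ah] fh] :=
  @lattice_stone_weierstrass R 'rV[R]_n K A f (eps / 4) Kco.
- exists (fun=> 0); split; last exact: approximable_cst.
  by apply: continuous_subspaceT; exact: cst_continuous.
- by move=> h [].
- move=> h k [hc ah] [kc ak]; split; last exact: approximable_max.
  exact: max_fun_continuous.
- move=> h k [hc ah] [kc ak]; split; last exact: approximable_min.
  exact: min_fun_continuous.
- by move=> x y Kx Ky; exact: approximable_interpolation.
- by [].
- by [].
have [F gF hF] := ah _ eps40; exists F => //.
have eps2 : eps / 2 < eps by rewrite ltr_pdivrMr // ltr_pMr // ltr1n.
apply: (@le_lt_trans _ _ (eps / 2)%:E); last by rewrite lte_fin.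
apply: ge_ereal_sup => _ [x Kx <-]; rewrite lee_fin.
rewrite -[f x](subrK (h x)) -addrA; apply: le_trans (ler_normD _ _) _.
by have := hF x Kx; have := fh x Kx; lra.
Qed.
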